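(* Let $n,k\ge 0$ be integers with $n\ge 2k$, and let $\Pi_{n,k}=\{w\in S_n : w_1<w_2<\cdots<w_{n-k},\ \operatorname{is}(w)=n-k\}$. Then $$\#\Pi_{n,k}=\sum_{r=0}^{k}(-1)^{k-r}\binom{k}{r}\frac{n!}{(n-r)!}.$$
   Context: Permutations $w\in S_n$ are written in one-line notation $w=w_1w_2\cdots w_n$. $\operatorname{is}(w)$ denotes the maximal length of an increasing subsequence of $w$. *)

(* Defs.v *)
From HB Require Import structures.
From mathcomp Require Import all_boot all_order all_algebra all_fingroup.

Set Implicit Arguments.
Unset Strict Implicit.
Unset Printing Implicit Defensive.

(* The one-line notation w_1 w_2 ... w_n of w : 'S_n is read with 0-based
   positions and values: w_(i+1) = (w i) + 1.  A subsequence of w is given by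
   its set A of positions. *)
Definition increasing_on (n : nat) (w : 'S_n) (A : {set 'I_n}) : bool :=
  [forall i in A, forall j in A, (i < j) ==> (w i < w j)].

Definition is_len (n : nat) (w : 'S_n) : nat :=
  \max_(A : {set 'I_n} | increasing_on w A) #|A|.

Definition Pi_set (n k : nat) : {set 'S_n} :=
  [set w : 'S_n | increasing_on w [set i : 'I_n | i < n - k]
                  & is_len w == n - k].

(* Main.v *)
(* For [n <= 2m], a permutation whose first [m] letters increase has no
   increasing subsequence longer than [m] iff, for each of these letters
   [w_i] ([i < m], 0-based), the letters of the tail (positions [>= m]) above
   [w_i] contain no increasing subsequence of length [m - i].  Let [P(n,m)] be
   the set of these permutations.  Take [s] in [P(n,m)] and a new value [x], with
   [j] letters below [x] among the first [m].  Either the tail letters above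
   [x] have longest increasing subsequence [< m - j], and putting [x] at
   position [m] yields every element of [P(n+1,m)] exactly once; or it is
   [= m - j], and putting [x] at its sorted position [j] yields every element
   of [P(n+1,m+1)] exactly once, since [j] is then the first position where
   the above criterion is tight.  Hence, when [n + 1 <= 2m],
     #P(n+1,m) + #P(n+1,m+1) = (n+1) #P(n,m),
   a recurrence which the alternating sum also satisfies. *)

Require Import Defs.
From HB Require Import structures.
From mathcomp Require Import all_boot all_order all_algebra all_fingroup.
From mathcomp Require Import zify.

Set Implicit Arguments.
Unset Strict Implicit.
Unset Printing Implicit Defensive.

(** * Increasing sets of positions *)

Lemma increasing_onP n (w : 'S_n) (A : {set 'I_n}) :
  reflect {in A &, forall i j : 'I_n, i < j -> w i < w j} (increasing_on w A).
Proof.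
apply: (iffP forall_inP) => [H i j iA jA ij | H i iA].
  by have /forall_inP/(_ j jA)/implyP/(_ ij) := H i iA.
by apply/forall_inP => j jA; apply/implyP; apply: H.
Qed.

Lemma increasing_onS n (w : 'S_n) (A B : {set 'I_n}) :
  A \subset B -> increasing_on w B -> increasing_on w A.
Proof.
move=> /subsetP sAB /increasing_onP incB; apply/increasing_onP => i j iA jA.
by apply: incB; apply: sAB.
Qed.

Lemma increasing_on0 n (w : 'S_n) : increasing_on w set0.
Proof. by apply/increasing_onP => i j; rewrite inE. Qed.

Lemma is_len_geq n (w : 'S_n) (A : {set 'I_n}) :
  increasing_on w A -> #|A| <= is_len w.
Proof. by move=> incA; apply: (@leq_bigmax_cond _ _ (fun A : {set 'I_n} => #|A|)). Qed.

Lemma card_ord_lt n m : m <= n -> #|[set i : 'I_n | i < m]| = m.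
Proof.
move=> mn; have wI : injective (widen_ord mn) by move=> i j /(congr1 val)/= /val_inj.
rewrite -[RHS](card_ord m) -(card_imset predT wI).
apply: eq_card => i; rewrite !inE; apply/idP/imsetP => [im|[j _ ->]] /=; last by [].
by exists (Ordinal im) => //; apply: val_inj.
Qed.

Lemma card_ord_lt_compl n m : m <= n -> #|~: [set i : 'I_n | i < m]| = n - m.
Proof. by move=> mn; rewrite cardsCs setCK card_ord card_ord_lt. Qed.

(** * Increasing subsequences of the tail and the membership criterion *)

(** The weak bound [y <= w i] fits both uses: for [y] a head letter it amounts to the strict one,
    and for a newly inserted value [x] the letters of [s] that end up above it are exactly those at
    least [x]. *)
Definition tail_is n (w : 'S_n) (m y : nat) : nat :=
  \max_(A : {set 'I_n} | increasing_on w A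
                         && (A \subset [set i : 'I_n | (m <= i) && (y <= w i)])) #|A|.

Lemma tail_is_geq n (w : 'S_n) m y (A : {set 'I_n}) :
  increasing_on w A -> A \subset [set i : 'I_n | (m <= i) && (y <= w i)] ->
  #|A| <= tail_is w m y.
Proof.
move=> incA sA; apply: (@leq_bigmax_cond _ _ (fun A : {set 'I_n} => #|A|)).
by rewrite incA.
Qed.

Lemma tail_is_ex n (w : 'S_n) m y :
  exists A : {set 'I_n}, [/\ increasing_on w A,
    A \subset [set i : 'I_n | (m <= i) && (y <= w i)] & #|A| = tail_is w m y].
Proof.
have P0 : 0 < #|[pred A : {set 'I_n} | increasing_on w A
              && (A \subset [set i : 'I_n | (m <= i) && (y <= w i)])]|.
  by apply/card_gt0P; exists set0; rewrite inE increasing_on0 sub0set.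
have [A] := eq_bigmax_cond (fun A : {set 'I_n} => #|A|) P0.
by rewrite inE => /andP[incA sA] eqA; exists A.
Qed.

Lemma tail_is_leq_size n (w : 'S_n) m y : m <= n -> tail_is w m y <= n - m.
Proof.
move=> mn; apply/bigmax_leqP => A /andP[_ sA].
have: #|A| <= #|~: [set i : 'I_n | i < m]|.
  apply: subset_leq_card; apply: subset_trans sA _.
  by apply/subsetP => i; rewrite !inE -leqNgt => /andP[].
by rewrite card_ord_lt_compl.
Qed.

(** This is P(n,m), indexed by the head length because the recurrence links [m] and [m.+1]. *)
Definition Pi_row n m : {set 'S_n} :=
  [set w : 'S_n | increasing_on w [set i : 'I_n | i < m] & is_len w == m].

(** The head up to [w i], followed by tail letters above [w i], is increasing, so failure at [i]
    produces a subsequence longer than [m]. Conversely, the last head position of an increasing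
    subsequence bounds both its head part and its tail part. *)
Lemma mem_Pi_row n m (w : 'S_n) : m <= n -> n <= 2 * m ->
  (w \in Pi_row n m) =
  increasing_on w [set i : 'I_n | i < m] &&
  [forall (i : 'I_n | i < m), tail_is w m (w i) + i < m].
Proof.
move=> mn nm; rewrite inE; case: (boolP (increasing_on _ _)) => //= incm.
have m_le : m <= is_len w by rewrite -{1}(card_ord_lt mn); apply: is_len_geq.
rewrite eqn_leq m_le andbT; apply/idP/forall_inP => [le_m i im | H].
  have [A [/increasing_onP incA /subsetP sA eqA]] := tail_is_ex w m (w i).
  pose I := [set j : 'I_n | j < i.+1].
  have dIA : [disjoint I & A].
    rewrite disjoint_subset; apply/subsetP => j; rewrite !inE => ji.
    apply/negP => /sA; rewrite inE => /andP[mj _]; lia.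
  have cardI : #|I| = i.+1 by apply: card_ord_lt; apply: ltn_ord.
  suff: #|I :|: A| <= is_len w by rewrite cardsU (disjoint_setI0 dIA) cards0 cardI eqA; lia.
  apply: is_len_geq; apply/increasing_onP => a b.
  have w_le (j : 'I_n) : j < i.+1 -> w j <= w i.
    rewrite ltnS leq_eqVlt => /orP[/eqP/val_inj -> // | ji].
    by apply/ltnW/(increasing_onP _ _ incm); rewrite ?inE //; lia.
  rewrite !inE => /orP[ai|aA] /orP[bi|bA] ab.
  - by apply: (increasing_onP _ _ incm); rewrite ?inE //; lia.
  - move: (sA _ bA); rewrite inE => /andP[mb wb].
    rewrite ltn_neqAle (leq_trans (w_le _ ai) wb) andbT.
    by apply: contraTneq ab => /val_inj/perm_inj ->; rewrite ltnn.
  - by move: (sA _ aA); rewrite inE => /andP[]; lia.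
  - exact: incA.
apply/bigmax_leqP => A incA.
(* A subsequence avoiding the head has at most [n - m] letters, and [n <= 2 * m] settles this
   case. *)
have [/exists_inP[i0 i0A i0m] | noA] := boolP [exists i in A, i < m]; last first.
  have: #|A| <= #|~: [set i : 'I_n | i < m]|.
    apply: subset_leq_card; apply/subsetP => i iA; rewrite !inE.
    by apply: contra noA => im; apply/exists_inP; exists i.
  rewrite card_ord_lt_compl //; lia.
pose P := [pred i : 'I_n | (i \in A) && (i < m)].
have Pi0 : P i0 by rewrite /= i0A.
case: (@arg_maxnP _ i0 P (fun i : 'I_n => i : nat) Pi0) => i /andP[iA im] maxi.
have := H i im.
have := @tail_is_geq _ w m (w i) (A :\: [set j : 'I_n | j < m]).
have <- : #|A :&: [set j : 'I_n | j < m]| + #|A :\: [set j : 'I_n | j < m]| = #|A|.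
  by rewrite cardsID.
have : #|A :&: [set j : 'I_n | j < m]| <= i.+1.
  rewrite -(card_ord_lt (ltn_ord i)); apply/subset_leq_card/subsetP => j.
  by rewrite !inE => /maxi.
move=> le1 le2.
suff: #|A :\: [set j : 'I_n | j < m]| <= tail_is w m (w i) by lia.
apply: le2; first by apply: increasing_onS incA; apply: subsetDl.
apply/subsetP => j; rewrite !inE -leqNgt => /andP[mj jA]; rewrite mj /=.
by apply/ltnW/(increasing_onP _ _ incA) => //; lia.
Qed.

(** * Insertion of a letter with [lift_perm] *)

(** Delete the letter at position [p] and close the gaps in positions and values; this is the
    surjectivity of insertion. *)
Lemma lift_perm_surj n (p : 'I_n.+1) (w : 'S_n.+1) :
  exists s : 'S_n, w = lift_perm p (w p) s.
Proof.
have neq i : w p != w (lift p i) by rewrite (inj_eq perm_inj) neq_lift.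
pose f i := s2val (unlift_some (neq i)).
have fE i : w (lift p i) = lift (w p) (f i).
  by rewrite /f; case: unlift_some.
have f_inj : injective f.
  by move=> i j fij; apply/(@lift_inj _ p)/(@perm_inj _ w); rewrite !fE fij.
exists (perm f_inj); apply/permP => i.
by case: (unliftP p i) => [j|] ->; rewrite ?lift_perm_id ?lift_perm_lift ?permE ?fE.
Qed.

Lemma lift_perm_inj n (p x : 'I_n.+1) : injective (lift_perm p x).
Proof.
move=> s t st; apply/permP => i; apply: (@lift_inj _ x).
by rewrite -!(lift_perm_lift p) st.
Qed.

Lemma increasing_on_lift n (p x : 'I_n.+1) (s : 'S_n) (A : {set 'I_n}) :
  increasing_on (lift_perm p x s) (lift p @: A) = increasing_on s A.
Proof.
apply/increasing_onP/increasing_onP => incA.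
  move=> i j iA jA ij.
  have := incA (lift p i) (lift p j) (imset_f _ iA) (imset_f _ jA).
  by rewrite !lift_perm_lift /= !ltnNge !leq_bump2 -!ltnNge; apply.
move=> _ _ /imsetP[i iA ->] /imsetP[j jA ->].
by rewrite !lift_perm_lift /= !ltnNge !leq_bump2 -!ltnNge; apply: incA.
Qed.

Lemma lift_preimsetK n (p : 'I_n.+1) (A : {set 'I_n.+1}) :
  p \notin A -> lift p @: (lift p @^-1: A) = A.
Proof.
move=> pA; apply/setP => i; apply/imsetP/idP => [[j]|iA].
  by rewrite inE => jA ->.
case: (unliftP p i) iA pA => [j|] -> iA pA; last by rewrite iA in pA.
by exists j; rewrite ?inE.
Qed.

(** The new letter lies before the tail, so only positions and values are relabelled; [unbump] pulls
    the threshold back through [lift x]. *)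
Lemma tail_is_lift n (p x : 'I_n.+1) (s : 'S_n) m y : p <= m ->
  tail_is (lift_perm p x s) m.+1 y = tail_is s m (unbump x y).
Proof.
move=> pm; apply/eqP; rewrite eqn_leq; apply/andP; split.
  have [A [incA /subsetP sA <-]] := tail_is_ex (lift_perm p x s) m.+1 y.
  have pA : p \notin A by apply/negP => /sA; rewrite inE; lia.
  rewrite -(lift_preimsetK pA) (card_imset _ (@lift_inj _ p)).
  apply: tail_is_geq; first by rewrite -(increasing_on_lift p x) lift_preimsetK.
  apply/subsetP => i; rewrite !inE => /sA.
  rewrite inE lift_perm_lift /= (leq_bump x) => /andP[+ ->].
  by rewrite /bump andbT; lia.
have [A [incA /subsetP sA <-]] := tail_is_ex s m (unbump x y).
rewrite -(card_imset _ (@lift_inj _ p)); apply: tail_is_geq.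
  by rewrite increasing_on_lift.
apply/subsetP => _ /imsetP[i /sA iA ->]; move: iA.
by rewrite !inE lift_perm_lift /= (leq_bump x) => /andP[+ ->]; rewrite /bump; lia.
Qed.

Lemma tail_is_lift_head n (p x : 'I_n.+1) (s : 'S_n) y :
  tail_is (lift_perm p x s) p y =
  maxn (tail_is s p (unbump x y)) (if y <= x then (tail_is s p x).+1 else 0).
Proof.
apply/eqP; rewrite eqn_leq geq_max; apply/and3P; split.
- have [A [incA /subsetP sA <-]] := tail_is_ex (lift_perm p x s) p y.
  have [pA|pA] := boolP (p \in A); last first.
    rewrite leq_max; apply/orP; left.
    rewrite -(lift_preimsetK pA) (card_imset _ (@lift_inj _ p)).
    apply: tail_is_geq; first by rewrite -(increasing_on_lift p x) lift_preimsetK.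
    apply/subsetP => i; rewrite !inE => /sA.
    rewrite inE lift_perm_lift /= (leq_bump x) => /andP[+ ->].
  by rewrite /bump andbT; lia.
  rewrite leq_max; apply/orP; right.
  have := sA _ pA; rewrite inE leqnn lift_perm_id /= => ->.
  rewrite (cardsD1 p) pA ltnS.
  have pA' : p \notin A :\ p by rewrite !inE eqxx.
  rewrite -(lift_preimsetK pA') (card_imset _ (@lift_inj _ p)).
  apply: tail_is_geq.
    rewrite -(increasing_on_lift p x) lift_preimsetK //.
    by apply: increasing_onS incA; apply: subsetDl.
  apply/subsetP => i; rewrite !inE => /andP[_ iA].
  have := sA _ iA; rewrite inE lift_perm_lift => /andP[pi _].
  have pi' : p < lift p i by rewrite ltn_neqAle pi neq_lift.
  have := increasing_onP _ _ incA _ _ pA iA pi'.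
  by rewrite lift_perm_id lift_perm_lift; move: pi' => /=; rewrite /bump; lia.
- have [A [incA /subsetP sA <-]] := tail_is_ex s p (unbump x y).
  rewrite -(card_imset _ (@lift_inj _ p)); apply: tail_is_geq.
    by rewrite increasing_on_lift.
  apply/subsetP => _ /imsetP[i /sA iA ->]; move: iA.
  by rewrite !inE lift_perm_lift /= (leq_bump x) => /andP[+ ->]; rewrite /bump; lia.
case: ifP => // yx.
have [A [incA /subsetP sA <-]] := tail_is_ex s p x.
rewrite -(card_imset _ (@lift_inj _ p)).
have pA : p \notin lift p @: A.
  by apply/imsetP => -[i _ /eqP]; rewrite (negPf (neq_lift _ _)).
have -> : #|lift p @: A|.+1 = #|p |: (lift p @: A)| by rewrite cardsU1 pA.
have sA' i : i \in lift p @: A -> p < i /\ x < lift_perm p x s i.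
  by case/imsetP => j /sA; rewrite inE => jA ->; rewrite lift_perm_lift /= /bump; lia.
apply: tail_is_geq; last first.
  apply/subsetP => i; rewrite !inE => /orP[/eqP ->|/sA' [/ltnW -> xi]]; last exact: leq_trans yx (ltnW xi).
  by rewrite leqnn lift_perm_id.
apply/increasing_onP => i j; rewrite !in_setU1 => /orP[/eqP ->|iA] /orP[/eqP ->|jA].
- by rewrite ltnn.
- by move=> _; rewrite lift_perm_id; case: (sA' _ jA).
- by case: (sA' _ iA); lia.
- by apply: (increasing_onP _ (lift p @: A)) => //; rewrite increasing_on_lift.
Qed.

(* When the first [m] letters of [s] increase, this is the number of those
   that are below [x]. *)
Definition insertion_pos n (s : 'S_n) (m x : nat) : nat :=
  \max_(i : 'I_n | (i < m) && (s i < x)) i.+1.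

Lemma insertion_pos_leq n (s : 'S_n) m x : insertion_pos s m x <= m.
Proof. by apply/bigmax_leqP => i /andP[]. Qed.

Lemma ltn_insertion_pos n (s : 'S_n) m x (i : 'I_n) :
  increasing_on s [set i : 'I_n | i < m] -> i < m ->
  (i < insertion_pos s m x) = (s i < x).
Proof.
move=> incm im; apply/idP/idP => [|six]; last first.
  by apply: (@leq_bigmax_cond _ _ (fun i : 'I_n => i.+1)); rewrite im.
apply: contraTT; rewrite -!leqNgt => xsi; apply/bigmax_leqP => j /andP[jm sjx].
rewrite ltnNge; apply/negP; rewrite leq_eqVlt => /orP[/eqP/val_inj ij|ij].
  by move: sjx; rewrite -ij; lia.
by have := increasing_onP _ _ incm i j; rewrite !inE => /(_ im jm ij); lia.
Qed.

Lemma insertion_pos_eq n (s : 'S_n) m x j : j <= m -> m <= n ->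
  (forall i : 'I_n, i < m -> (s i < x) = (i < j)) -> insertion_pos s m x = j.
Proof.
move=> jm mn H; apply/eqP; rewrite eqn_leq; apply/andP; split.
  by apply/bigmax_leqP => i /andP[im]; rewrite H.
case: j jm H => // j jm H.
have jn : j < n by lia.
apply: (@leq_bigmax_cond _ _ (fun i : 'I_n => i.+1) (Ordinal jn)).
by rewrite H /= ?jm ?ltnSn.
Qed.

(** * The dichotomy of insertions *)

(** The criterion at the last head letter below [x] gives the bound, since tail letters above [x]
    are also above that letter. Hence the sum is either [< m] or [= m], which separates the two
    insertions. *)
Lemma Pi_row_slack n (s : 'S_n) m x : m <= n -> n <= 2 * m ->
  s \in Pi_row n m -> tail_is s m x + insertion_pos s m x <= m.
Proof.
move=> mn nm; rewrite mem_Pi_row // => /andP[incm /forall_inP H].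
have := insertion_pos_leq s m x.
case E : (insertion_pos s m x) => [|i] im.
  by have := tail_is_leq_size s x mn; lia.
have i_n : i < n by lia.
have := H (Ordinal i_n) im.
have := ltn_insertion_pos x incm (i := Ordinal i_n) im.
rewrite /= E ltnSn => /esym six.
suff : tail_is s m x <= tail_is s m (s (Ordinal i_n)) by lia.
have [A [incA /subsetP sA <-]] := tail_is_ex s m x.
apply: tail_is_geq => //; apply/subsetP => j /sA; rewrite !inE; lia.
Qed.

(** Only head letters below [x] see the new tail letter, which offers them subsequences of length
    [(tail_is s p x).+1]. *)
Lemma mem_Pi_row_lift_end n (s : 'S_n) (p x : 'I_n.+1) :
  n.+1 <= 2 * p ->
  (lift_perm p x s \in Pi_row n.+1 p) =
  (s \in Pi_row n p) && (tail_is s p x + insertion_pos s p x < p).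
Proof.
move=> np; have pn : p <= n by rewrite -ltnS.
rewrite !mem_Pi_row //; [|lia|lia].
have -> : [set i : 'I_n.+1 | i < p] = lift p @: [set i : 'I_n | i < p].
  apply/setP => i; rewrite inE; case: (unliftP p i) => [j|] ->.
    rewrite (mem_imset _ _ (@lift_inj _ p)) inE /= /bump; lia.
  rewrite ltnn; apply/esym/negP => /imsetP[j _ /eqP].
  by rewrite (negPf (neq_lift _ _)).
rewrite increasing_on_lift; case: (boolP (increasing_on _ _)) => //= incp.
have liftE (i : 'I_n) : i < p -> lift p i = i :> nat by rewrite /= /bump; lia.
have xn := ltn_ord x.
apply/forall_inP/andP => [H | [/forall_inP H tight] i ip].
  have Hs (i : 'I_n) : i < p -> tail_is s p (s i) + i < p /\
      (s i < x -> (tail_is s p x).+1 + i < p).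
    move=> ip; have := H (lift p i); rewrite liftE // => /(_ ip).
    rewrite lift_perm_lift tail_is_lift_head /= bumpK.
    case: (leqP x (s i)) => six; rewrite /bump ?six; [|case: ifP]; lia.
  split; first by apply/forall_inP => i /Hs[].
  have := insertion_pos_leq s p x.
  (* With no head letter below [x], the tail has at most [n - p < p] letters; otherwise the last
     head letter below [x] gives the sharpest bound. *)
  case E : (insertion_pos s p x) => [|i] ip.
    by have := tail_is_leq_size s x pn; lia.
  have i_n : i < n by lia.
  have := ltn_insertion_pos x incp (i := Ordinal i_n) ip.
  rewrite /= E ltnSn => /esym six.
  by have [_ /(_ six)] := Hs (Ordinal i_n) ip; rewrite /=; lia.
case: (unliftP p i) ip => [j|] ->; last by rewrite ltnn.
move=> jp; have jp' : j < p by move: jp; rewrite /= /bump; lia.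
rewrite lift_perm_lift tail_is_lift_head liftE //= bumpK.
have := H j jp'; have := ltn_insertion_pos x incp jp'.
case: ifP; rewrite /bump; lia.
Qed.

(* The left-hand side says that [p] is the first position at which the
   criterion [mem_Pi_row] holds with no slack. *)
Lemma mem_Pi_row_lift_sorted n (s : 'S_n) m (p x : 'I_n.+1) :
  m <= n -> n <= 2 * m -> p <= m ->
  [&& lift_perm p x s \in Pi_row n.+1 m.+1,
      tail_is (lift_perm p x s) m.+1 x + p == m &
      [forall (i : 'I_n.+1 | i < p),
        tail_is (lift_perm p x s) m.+1 (lift_perm p x s i) + i < m]] =
  [&& s \in Pi_row n m, tail_is s m x + insertion_pos s m x == m &
      insertion_pos s m x == p].
Proof.
move=> mn nm pm; rewrite !mem_Pi_row //; [|lia].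
set v := lift_perm p x s.
have vp : v p = x by rewrite lift_perm_id.
have vl i : v (lift p i) = lift x (s i) by rewrite lift_perm_lift.
have tl i : tail_is v m.+1 (lift x (s i)) = tail_is s m (s i).
  by rewrite tail_is_lift //= bumpK.
have tx : tail_is v m.+1 x = tail_is s m x.
  by rewrite tail_is_lift // /unbump ltnn subn0.
rewrite tx.
have lift_lt (i : 'I_n) : (lift p i < m.+1) = (i < m).
  by rewrite /= /bump; lia.
apply/idP/idP.
  case/and3P => /andP[/increasing_onP incv /forall_inP Hv] /eqP tight /forall_inP first.
  have incs : increasing_on s [set i : 'I_n | i < m].
    apply/increasing_onP => i j; rewrite !inE => im jm ij.
    have := incv (lift p i) (lift p j); rewrite !inE !lift_lt !vl.
    by rewrite /= !ltnNge !leq_bump2 -!ltnNge; apply.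
  (* The head of [v] increases through position [p], so [x] sits at its sorted place. *)
  have pE : insertion_pos s m x = p.
    apply: insertion_pos_eq => // i im.
    have inc1 := incv (lift p i) p; have inc2 := incv p (lift p i).
    move: inc1 inc2; rewrite !inE !lift_lt vl vp /= ltnS => /(_ im pm) + /(_ pm im).
    by rewrite /bump; lia.
  rewrite incs pE tight !eqxx !andbT /=.
  apply/forall_inP => i im.
  (* Before [p] the strict slack from [first] is needed, as the bound drops from [m.+1] to [m]; from
     [p] on, the shift of positions by one compensates for the drop. *)
  case: (ltnP i p) => ip.
    have := first (lift p i); rewrite vl tl /= /bump; lia.
  by have := Hv (lift p i); rewrite lift_lt vl tl /= /bump; lia.
case/and3P => /andP[incs /forall_inP Hs] tight /eqP pE.
rewrite pE in tight; rewrite tight /= -andbA; apply/and3P; split.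
- apply/increasing_onP => i j; rewrite !inE.
  case: (unliftP p i) => [i'|] ->; case: (unliftP p j) => [j'|] ->;
    rewrite ?lift_lt ?vl ?vp.
  + move=> im jm; rewrite /= !ltnNge !leq_bump2 -!ltnNge => ij.
    by apply: (increasing_onP _ _ incs); rewrite ?inE.
  + move=> im _; have := ltn_insertion_pos x incs im.
    by rewrite pE /= /bump; lia.
  + move=> _ jm; have := ltn_insertion_pos x incs jm.
    by rewrite pE /= /bump; lia.
  + by rewrite ltnn.
- apply/forall_inP => i; case: (unliftP p i) => [j|] ->.
    rewrite lift_lt vl tl => jm; have := Hs j jm.
    by rewrite /= /bump; lia.
  by rewrite vp tx; lia.
apply/forall_inP => i; case: (unliftP p i) => [j|] ->; last by rewrite ltnn.
rewrite vl tl => jp; have jm : j < m by move: jp; rewrite /= /bump; lia.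
by have := Hs j jm; move: jp; rewrite /= /bump; lia.
Qed.

(** * The recurrence for the cardinalities *)

Lemma card_Pi_row_rec n m : m <= n -> n.+1 <= 2 * m ->
  #|Pi_row n.+1 m| + #|Pi_row n.+1 m.+1| = n.+1 * #|Pi_row n m|.
Proof.
move=> mn nm; have nm' : n <= 2 * m by lia.
pose X := setX (Pi_row n m) [set: 'I_n.+1].
pose slack (u : 'S_n * 'I_n.+1) := tail_is u.1 m u.2 + insertion_pos u.1 m u.2.
pose p : 'I_n.+1 := Ordinal (mn : m < n.+1).
have [pos posE] : exists pos : 'S_n * 'I_n.+1 -> 'I_n.+1,
    forall u, pos u = insertion_pos u.1 m u.2 :> nat.
  exists (fun u : 'S_n * 'I_n.+1 => inord (insertion_pos u.1 m u.2)) => u.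
  by rewrite inordK // ltnS (leq_trans (insertion_pos_leq _ _ _)).
have pos_m u : pos u <= m by rewrite posE insertion_pos_leq.
pose f1 (u : 'S_n * 'I_n.+1) := lift_perm p u.2 u.1.
pose f2 (u : 'S_n * 'I_n.+1) := lift_perm (pos u) u.2 u.1.
pose tightp (v : 'S_n.+1) (q : 'I_n.+1) := tail_is v m.+1 (v q) + q.
have -> : n.+1 * #|Pi_row n m| = #|X| by rewrite cardsX cardsT card_ord mulnC.
(* Pairs with slack below [m] correspond to [Pi_row n.+1 m] through [f1], the others to
   [Pi_row n.+1 m.+1] through [f2]. *)
rewrite -(cardsID [set u | slack u < m] X); congr (_ + _).
  have f1_inj : injective f1.
    move=> [s x] [t y]; rewrite /f1 /= => st.
    have xy : x = y by rewrite -(lift_perm_id p x s) st lift_perm_id.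
    by rewrite xy in st *; rewrite (lift_perm_inj st).
  rewrite -(card_imset _ f1_inj); apply: eq_card => w.
  apply/idP/imsetP => [wP|[[s x]]].
    have [s ws] := lift_perm_surj p w; exists (s, w p) => //.
    have := @mem_Pi_row_lift_end _ s p (w p) nm; rewrite -ws wP => /esym.
    by rewrite in_setI [X in _ -> _ && X]in_set in_setX in_setT andbT.
  rewrite in_setI [X in _ && X]in_set in_setX in_setT andbT => sP ->.
  by rewrite (@mem_Pi_row_lift_end _ s p x nm).
have A2P u : u \in X :\: [set u | slack u < m] ->
   [&& f2 u \in Pi_row n.+1 m.+1, tightp (f2 u) (pos u) == m &
     [forall (i : 'I_n.+1 | i < pos u), tightp (f2 u) i < m]].
  case: u => s x; rewrite in_setD [X in ~~ X]in_set in_setX in_setT andbT -leqNgt => /andP[sl sP].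
  have := mem_Pi_row_lift_sorted s x mn nm' (pos_m (s, x)).
  have slE : tail_is s m x + insertion_pos s m x == m.
    by rewrite eqn_leq Pi_row_slack.
  have pE : insertion_pos s m x == pos (s, x) by rewrite posE.
  by rewrite sP slE pE /tightp /f2 /= lift_perm_id.
have f2_inj : {in X :\: [set u | slack u < m] &, injective f2}.
  move=> u u' /A2P/and3P[_ /eqP t1 /forall_inP F1] /A2P/and3P[_ /eqP t2 /forall_inP F2] eqf.
  (* The insertion position varies with the pair, but it is recovered from the image as the first
     tight position. *)
  have eqp : pos u = pos u'.
    case: (ltngtP (pos u) (pos u')) => [lt12|lt21|/ord_inj //].
      by have := F2 (pos u) lt12; rewrite -eqf t1 ltnn.
    by have := F1 (pos u') lt21; rewrite eqf t2 ltnn.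
  move: eqf; rewrite /f2 -eqp; move: (pos u) => q.
  case: u u' {t1 t2 F1 F2 eqp} => [s x] [t y] /= st.
  have xy : x = y by rewrite -(lift_perm_id q x s) st lift_perm_id.
  by rewrite xy in st *; rewrite (lift_perm_inj st).
rewrite -(card_in_imset f2_inj); apply: eq_card => v.
apply/idP/imsetP => [vP|[u /A2P/and3P[uP _ _] -> //]].
have := vP; rewrite mem_Pi_row //; last by lia.
case/andP => _ /forall_inP Hv.
pose P := [pred q : 'I_n.+1 | (q <= m) && (tightp v q == m)].
have [q [qm tq first]] : exists q : 'I_n.+1, [/\ q <= m, tightp v q == m &
    forall i : 'I_n.+1, i < q -> tightp v i < m].
  (* A tight position exists: at position [m] the criterion bounds [tightp v p] by [m], and it is at
     least [m] by definition. *)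
  have Pp : P p by have := Hv p (ltnSn m); rewrite /= leqnn /tightp /=; lia.
  case: (@arg_minnP _ p P (fun i : 'I_n.+1 => i : nat) Pp) => q /andP[qm tq] qmin.
  exists q => //; split => // i iq; have im : i < m.+1 by lia.
  rewrite ltn_neqAle -ltnS (Hv i im) andbT; apply/negP => ti.
  by have := qmin i; rewrite /= ti; lia.
have [s vs] := lift_perm_surj q v.
have := mem_Pi_row_lift_sorted s (v q) mn nm' qm.
have -> : [forall (i : 'I_n.+1 | i < q),
    tail_is (lift_perm q (v q) s) m.+1 (lift_perm q (v q) s i) + i < m].
  by apply/forall_inP; rewrite -vs.
rewrite -vs vP -/(tightp v q) tq => /esym/and3P[sP /eqP sl /eqP pE].
exists (s, v q); last first.
  rewrite vs /f2; congr (lift_perm _ _ _); last by rewrite -vs.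
  by apply: ord_inj; rewrite posE -vs pE.
by rewrite in_setD in_setX in_setT andbT sP in_set /slack /= sl ltnn.
Qed.

(** * The base case: head of full length *)

(** Since [w] preserves and reflects order, as many values lie below [w i] as positions below
    [i]. *)
Lemma increasing_on_setT n (w : 'S_n) : increasing_on w setT -> w = 1%g.
Proof.
move=> /increasing_onP incw.
have ltw (i j : 'I_n) : (w j < w i) = (j < i).
  apply/idP/idP => [|ji]; last by apply: incw; rewrite ?inE.
  apply: contraTT; rewrite -!leqNgt leq_eqVlt => /orP[/eqP/val_inj -> //|ij].
  by apply: ltnW; apply: incw; rewrite ?inE.
apply/permP => i; rewrite perm1; apply/val_inj => /=.
rewrite -{1}(card_ord_lt (ltnW (ltn_ord (w i)))) -(card_ord_lt (ltnW (ltn_ord i))).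
rewrite -[RHS](card_imset _ (@perm_inj _ w)).
apply: eq_card => j; rewrite inE -(permKV w j) ltw.
by rewrite (mem_imset _ _ (@perm_inj _ w)) inE.
Qed.

Lemma card_Pi_row_full n : #|Pi_row n n| = 1.
Proof.
have fullT : [set i : 'I_n | i < n] = setT by apply/setP => i; rewrite !inE ltn_ord.
apply/eqP/cards1P; exists 1%g; apply/setP => w; rewrite !inE fullT.
apply/andP/eqP => [[/increasing_on_setT]//|->].
have inc1 : increasing_on (1%g : 'S_n) setT.
  by apply/increasing_onP => i j; rewrite !perm1.
split=> //; have := is_len_geq inc1.
rewrite cardsT card_ord eqn_leq => ->; rewrite andbT.
by apply/bigmax_leqP => A _; rewrite -[leqRHS](card_ord n) max_card.
Qed.

(** * The alternating sum and the final count *)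

Import GRing.Theory.
Local Open Scope ring_scope.

Definition falling_alt_sum (n k : nat) : int :=
  \sum_(r < k.+1) (-1) ^+ (k - r) * ('C(k, r))%:Z * (n ^_ r)%:Z.

(** Pascal's rule splits the terms with [r > 0]: the part with ['C(k, r)], after the index shift,
    yields the multiple of [n.+1] by [ffactSS]; the other part joins the term [r = 0] and gives the
    second sum with its sign flipped. *)
Lemma falling_alt_sum_rec n k :
  falling_alt_sum n.+1 k.+1 = n.+1%:Z * falling_alt_sum n k - falling_alt_sum n.+1 k.
Proof.
rewrite /falling_alt_sum big_ord_recl [X in _ - X]big_ord_recl.
rewrite !bin0 !ffactn0 !subn0 exprS.
under eq_bigr => r _ do
  rewrite lift0 binS subSS ffactSS PoszD PoszM mulrDr mulrDl.
rewrite big_split [X in _ + (X + _)]big_ord_recr /= bin_small // mulr0 mul0r addr0.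
rewrite mulr_sumr opprD -sumrN addrA addrC; congr (_ + _).
  by apply: eq_bigr => r _; rewrite mulrCA !mulrA.
congr (_ + _); first by rewrite mulN1r !mulNr.
apply: eq_bigr => r _; rewrite /= /bump leq0n add1n ffactSS PoszM -mulNr -mulNr.
congr (_ * _ * _).
by rewrite -[RHS]mulN1r -exprS; congr (_ ^+ _); have := ltn_ord r; lia.
Qed.

Lemma card_Pi_row n k : (2 * k <= n)%N ->
  (#|Pi_row n (n - k)|)%:Z = falling_alt_sum n k.
Proof.
elim: k n => [|k IHk] n kn.
  by rewrite subn0 card_Pi_row_full /falling_alt_sum big_ord1 ffactn0.
case: n kn => [//|n] kn; rewrite subSS falling_alt_sum_rec.
have nk : (2 * k <= n)%N by lia.
have nk' : (2 * k <= n.+1)%N by lia.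
rewrite -(IHk n nk) -(IHk n.+1 nk') subSn; last by lia.
(* The hypothesis [2 * k.+1 <= n.+1] is exactly the condition [n.+1 <= 2 * (n - k)] of the
   recurrence. *)
have := @card_Pi_row_rec n (n - k); lia.
Qed.

Theorem theorem1 (n k : nat) (hnk : (2 * k <= n)%N) :
  (#|Pi_set n k|)%:Z =
  \sum_(r < k.+1)
    (-1) ^+ (k - r) * ('C(k, r))%:Z * ((n`! %/ (n - r)`!)%N)%:Z.
Proof.
(* [Pi_set n k] is [Pi_row n (n - k)] by conversion; the quotient of factorials is [n ^_ r] because
   [r <= k <= n]. *)
rewrite [LHS](card_Pi_row hnk); apply: eq_bigr => r _.
by rewrite ffact_factd //; have := ltn_ord r; lia.
Qed.
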